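(* Let $\mathcal D(X)$ be the ring of differential operators on a smooth irreducible affine algebraic variety $X$ over a field $K$ of characteristic zero, and let $a\in\mathcal D(X)$. Then, for an arbitrary polynomial $f(t)\in K[t]$ of degree $>1$, $0$ is the only eigenvalue of the inner derivation $\operatorname{ad} f(a)$ of $\mathcal D(X)$; that is, if $[f(a),b]=\lambda b$ for some $\lambda\in K$ and $0\neq b\in\mathcal D(X)$, then $\lambda=0$.
   Context: For a commutative $K$-algebra $R$, the ring of ($K$-linear) differential operators $\mathcal D(R)=\bigcup_{i\ge0}\mathcal D(R)_i\subseteq \operatorname{End}_K(R)$ is defined by $\mathcal D(R)_0=\{f\in\operatorname{End}_K(R): fr-rf=0 \text{ for all } r\in R\}=\operatorname{End}_R(R)=R$ and $\mathcal D(R)_i=\{f\in\operatorname{End}_K(R): fr-rf\in\mathcal D(R)_{i-1}\text{ for all } r\in R\}$. For a smooth irreducible affine variety $X$ with coordinate algebra $\mathcal O(X)$ (a commutative affine regular domain), $\mathcal D(X):=\mathcal D(\mathcal O(X))$. For $u$ in an algebra, $\operatorname{ad} u$ is the inner derivation $b\mapsto[u,b]=ub-bu$. *)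

(* Defs.v *)
From HB Require Import structures.
From mathcomp Require Import all_boot all_order all_algebra.
From mathcomp Require Import ring_quotient boolp functions.

Set Implicit Arguments.
Unset Strict Implicit.
Unset Printing Implicit Defensive.

Import GRing.Theory.
Local Open Scope ring_scope.

#[short(type="idomainAlgType")]
HB.structure Definition IdomainAlgebra (K : nzRingType) :=
  {R of GRing.ComUnitAlgebra K R & GRing.IntegralDomain R}.

Section Ideals.
Variable A : comNzRingType.

(* The library's [idealr] and [prime_idealr] are proper ideals. *)
Definition maximal_ideal (m : idealr A) : Prop :=
  forall J : idealr A, {subset m <= J} -> m =i J.

Definition ideal_generated_by (n : nat) (x : 'I_n -> A) (I : {pred A}) : Prop :=
  forall y, y \in I <-> exists c : 'I_n -> A, y = \sum_(i < n) c i * x i.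

(* The improper ideal is omitted: it is generated by 1. *)
Definition noetherian : Prop :=
  forall I : idealr A, exists (n : nat) (x : 'I_n -> A), ideal_generated_by x I.

Definition prime_chain (n : nat) (P : 'I_n.+1 -> prime_idealr A) : Prop :=
  forall i j : 'I_n.+1, (i < j)%N ->
    {subset P i <= P j} /\ ~ {subset P j <= P i}.

Definition has_krull_dim (d : nat) : Prop :=
  (exists P : 'I_d.+1 -> prime_idealr A, prime_chain P) /\
  (forall (n : nat) (P : 'I_n.+1 -> prime_idealr A),
     prime_chain P -> (n <= d)%N).

Definition regular_local_ring : Prop :=
  noetherian /\
  exists m : idealr A,
    [/\ maximal_ideal m,
        forall m' : idealr A, maximal_ideal m' -> m' =i m &
        exists2 d : nat, has_krull_dim d &
          exists x : 'I_d -> A, ideal_generated_by x m].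

End Ideals.

Section Localization.
Variables (R : idomainType) (p : prime_idealr R).

Definition localization_pred : {pred {fraction R}} :=
  [pred z | `[< exists x y : R, y \notin p /\ z = tofrac x / tofrac y >]].

Lemma localization_predP z :
  reflect (exists x y : R, y \notin p /\ z = tofrac x / tofrac y)
          (z \in localization_pred).
Proof. exact: asboolP. Qed.

Lemma localization_subring : subring_closed localization_pred.
Proof.
have nz y : y \notin p -> tofrac y != 0.
  by apply: contra; rewrite tofrac_eq0 => /eqP->; apply: rpred0.
split=> [|u v|u v].
- apply/localization_predP; exists 1, 1.
  by rewrite idealr1 tofrac1 divr1.
- move=> /localization_predP[x [y [py ->]]] /localization_predP[x' [y' [py' ->]]].
  apply/localization_predP; exists (x * y' - x' * y), (y * y').
  rewrite prime_idealrM negb_or py py'; split=> //.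
  by rewrite -mulNr addf_div ?nz // -tofracN -!tofracM -tofracD mulNr.
- move=> /localization_predP[x [y [py ->]]] /localization_predP[x' [y' [py' ->]]].
  apply/localization_predP; exists (x * x'), (y * y').
  rewrite prime_idealrM negb_or py py'; split=> //.
  by rewrite mulf_div !tofracM.
Qed.

Record localization := Localization {
  localization_val :> {fraction R};
  _ : localization_val \in localization_pred }.

HB.instance Definition _ := [isSub for localization_val].
HB.instance Definition _ := [Choice of localization by <:].
HB.instance Definition _ := GRing.SubChoice_isSubComNzRing.Build
  {fraction R} localization_pred localization localization_subring.

End Localization.

Definition regular_ring (R : idomainType) : Prop :=
  noetherian R /\
  forall p : prime_idealr R, regular_local_ring (localization p).

Definition affine_algebra (K : fieldType) (R : comAlgType K) : Prop :=
  exists s : seq R, forall S : {pred R},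
    subalg_closed S -> {subset s <= S} -> forall x, x \in S.

Section Endomorphisms.
Variables (K : fieldType) (R : comAlgType K).

Definition endo_pred : {pred R -> R} := [pred f : R -> R | `[< linear f >]].

Lemma endo_predP (f : R -> R) : reflect (linear f) (f \in endo_pred).
Proof. exact: asboolP. Qed.

Record endo := Endo { endo_fun :> R -> R; _ : endo_fun \in endo_pred }.

HB.instance Definition _ := [isSub for endo_fun].
HB.instance Definition _ := [Choice of endo by <:].

Lemma endo_submod : subsemimod_closed endo_pred.
Proof.
split.
  split.
    by apply/endo_predP => k x y; rewrite /= scaler0 addr0.
  move=> f g /endo_predP fl /endo_predP gl; apply/endo_predP => k x y.
  by rewrite !fctE fl gl scalerDr !addrA; congr (_ + _); rewrite addrAC.
move=> c f /endo_predP fl; apply/endo_predP => k x y.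
by rewrite !fctE fl scalerDr !scalerA mulrC.
Qed.

HB.instance Definition _ := GRing.SubChoice_isSubLmodule.Build
  K (R -> R) endo_pred endo endo_submod.

Lemma endoP (f g : endo) : (forall x, f x = g x) -> f = g.
Proof. by move=> fg; apply/val_inj/funext. Qed.

Lemma endo_linear (f : endo) : linear f.
Proof. by apply/endo_predP; case: f. Qed.

HB.instance Definition _ (f : endo) :=
  GRing.isLinear.Build K R R *:%R (endo_fun f) (endo_linear f).

Fact endo_one_subproof : (idfun : R -> R) \in endo_pred.
Proof. exact/endo_predP. Qed.
Definition endo_one : endo := Endo endo_one_subproof.

Fact endo_mul_subproof (f g : endo) : (f \o g : R -> R) \in endo_pred.
Proof. by apply/endo_predP => k x y /=; rewrite !linearP. Qed.
Definition endo_mul (f g : endo) : endo := Endo (endo_mul_subproof f g).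

Lemma endoDE (f g : endo) x : (f + g) x = f x + g x.
Proof. by []. Qed.
Lemma endoZE (c : K) (f : endo) x : (c *: f) x = c *: f x.
Proof. by []. Qed.

Fact endo_mulA : associative endo_mul.
Proof. by move=> f g h; apply: endoP. Qed.
Fact endo_mul1l : left_id endo_one endo_mul.
Proof. by move=> f; apply: endoP. Qed.
Fact endo_mul1r : right_id endo_one endo_mul.
Proof. by move=> f; apply: endoP. Qed.
Fact endo_mulDl : left_distributive endo_mul +%R.
Proof. by move=> f g h; apply: endoP. Qed.
Fact endo_mulDr : right_distributive endo_mul +%R.
Proof. by move=> f g h; apply: endoP => x; apply: (linearD f). Qed.
Fact endo_one_neq0 : endo_one != 0.
Proof.
apply/eqP => /(congr1 (fun f : endo => f 1)) /= /eqP.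
exact/negP/oner_neq0.
Qed.

HB.instance Definition _ := GRing.Zmodule_isNzRing.Build endo
  endo_mulA endo_mul1l endo_mul1r endo_mulDl endo_mulDr endo_one_neq0.

Fact endo_scaleAl (c : K) (f g : endo) : c *: (f * g) = (c *: f) * g.
Proof. by apply: endoP. Qed.
HB.instance Definition _ := GRing.Lmodule_isLalgebra.Build K endo endo_scaleAl.

Fact endo_scaleAr (c : K) (f g : endo) : c *: (f * g) = f * (c *: g).
Proof. by apply: endoP => x; apply/esym/(linearZ_LR f). Qed.
HB.instance Definition _ := GRing.Lalgebra_isAlgebra.Build K endo endo_scaleAr.

Fact endo_mulop_subproof (r : R) : ( *%R r : R -> R) \in endo_pred.
Proof. by apply/endo_predP => k x y; rewrite mulrDr scalerAr. Qed.
Definition endo_mulop (r : R) : endo := Endo (endo_mulop_subproof r).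

Fixpoint diffop_order_le (i : nat) (f : endo) : Prop :=
  match i with
  | 0 => forall r, f * endo_mulop r - endo_mulop r * f = 0
  | j.+1 => forall r, diffop_order_le j (f * endo_mulop r - endo_mulop r * f)
  end.

Definition diffop_pred : {pred endo} :=
  [pred f | `[< exists i, diffop_order_le i f >]].

Lemma diffop_predP f :
  reflect (exists i, diffop_order_le i f) (f \in diffop_pred).
Proof. exact: asboolP. Qed.

Lemma diffop_order_le0 i : diffop_order_le i 0.
Proof.
by elim: i => [|i IH] r /=; rewrite mul0r mulr0 subr0.
Qed.

Lemma diffop_order_leS i f : diffop_order_le i f -> diffop_order_le i.+1 f.
Proof.
elim: i f => [|i IH] f fi r; last exact/IH/fi.
by rewrite fi; apply: (diffop_order_le0 0).
Qed.

Lemma diffop_order_leW i j f :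
  (i <= j)%N -> diffop_order_le i f -> diffop_order_le j f.
Proof.
move=> /subnKC <-; elim: (j - i)%N => [|k IH] fi; first by rewrite addn0.
by rewrite addnS; apply/diffop_order_leS/IH.
Qed.

Lemma diffop_order_le_linear i c f g : diffop_order_le i f ->
  diffop_order_le i g -> diffop_order_le i (c *: f + g).
Proof.
have E h h' r : (c *: h + h') * endo_mulop r - endo_mulop r * (c *: h + h') =
    c *: (h * endo_mulop r - endo_mulop r * h) +
    (h' * endo_mulop r - endo_mulop r * h').
  by rewrite mulrDl mulrDr -scalerAl -scalerAr scalerBr opprD addrACA.
elim: i f g => [|i IH] f g fi gi r; first by rewrite E fi gi scaler0 addr0.
by rewrite E; apply: IH; [exact: fi | exact: gi].
Qed.

Lemma diffop_order_leM i j f g : diffop_order_le i f ->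
  diffop_order_le j g -> diffop_order_le (i + j) (f * g).
Proof.
have E h h' r : h * h' * endo_mulop r - endo_mulop r * (h * h') =
    1 *: (h * (h' * endo_mulop r - endo_mulop r * h')) +
    (h * endo_mulop r - endo_mulop r * h) * h'.
  by rewrite scale1r mulrBr mulrBl !mulrA addrA subrK.
move: {2}(i + j)%N (erefl (i + j)%N) => n.
elim: n i j f g => [|n IH] i j f g.
  move=> /eqP; rewrite addn_eq0 => /andP[/eqP-> /eqP->] fi gi r.
  by rewrite E fi gi mulr0 mul0r scaler0 addr0.
move=> ij fi gj; rewrite ij => r; rewrite E.
apply: diffop_order_le_linear.
  case: j ij gj => [|j] ij gj; first by rewrite gj mulr0; apply: diffop_order_le0.
  have ijn : (i + j)%N = n by move: ij; rewrite addnS => -[].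
  by rewrite -ijn; apply: IH ijn fi (gj r).
case: i ij fi => [|i] ij fi; first by rewrite fi mul0r; apply: diffop_order_le0.
have ijn : (i + j)%N = n by move: ij; rewrite addSn => -[].
by rewrite -ijn; apply: IH ijn (fi r) gj.
Qed.

Lemma diffop_subalg : subalg_closed diffop_pred.
Proof.
split.
- by apply/diffop_predP; exists 0%N => r; rewrite mul1r mulr1 subrr.
- move=> c f g /diffop_predP[i fi] /diffop_predP[j gj].
  apply/diffop_predP; exists (maxn i j).
  by apply: diffop_order_le_linear;
    [apply: diffop_order_leW fi; apply: leq_maxl |
     apply: diffop_order_leW gj; apply: leq_maxr].
- move=> f g /diffop_predP[i fi] /diffop_predP[j gj].
  by apply/diffop_predP; exists (i + j)%N; apply: diffop_order_leM.
Qed.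

Record diffop := Diffop { diffop_val :> endo; _ : diffop_val \in diffop_pred }.

HB.instance Definition _ := [isSub for diffop_val].
HB.instance Definition _ := [Choice of diffop by <:].
HB.instance Definition _ := GRing.SubChoice_isSubAlgebra.Build
  K endo diffop_pred diffop (GRing.subalg_closed_semi diffop_subalg).

End Endomorphisms.

Section InnerDerivation.
Variables (K : fieldType) (A : algType K).

Definition ad (u b : A) : A := u * b - b * u.

Fact ad_linear u : linear (ad u).
Proof.
move=> c x y; rewrite /ad mulrDr mulrDl scalerBr scalerAr scalerAl.
by rewrite opprD addrACA.
Qed.
HB.instance Definition _ u := GRing.isLinear.Build K A A *:%R (ad u) (ad_linear u).

End InnerDerivation.

Definition is_eigenvalue (K : fieldType) (V : lmodType K)
    (phi : {linear V -> V}) (lam : K) : Prop :=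
  exists2 v : V, v != 0 & phi v = lam *: v.

(* Main.v *)
Require Import Defs.
From HB Require Import structures.
From mathcomp Require Import all_boot all_algebra.
From mathcomp Require Import boolp zify.

(** Filter the differential operators by order.  The associated graded ring is
    a commutative domain: commutative because [[P, Q], r] =
    [[P, r], Q] + [P, [Q, r]] lets the order of a commutator be estimated by
    induction ([order_lt_comm]), and a domain because commutation with an
    element of R is a derivation lowering the order by one, which reduces the
    product of two symbols to a product in R ([order_lt_domain]).  The second
    point divides by binomial coefficients, hence characteristic zero.

    The theorem holds in every algebra with such a filtration
    ([ad_horner_eigenvalue0]).  Let f have degree d, let [f(a), b] = lam b with
    lam and b nonzero, and put c = [a, b].
    - If a has order 0, then ad f(a) lowers the order, so b cannot be an
      eigenvector.
    - If a has order m > 0, then modulo lower order [a^i, b] is i a^(i-1) c,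
      because the graded ring is commutative.  The leading term of f therefore
      dominates, and [f(a), b] has order exactly (d - 1) m + ord c
      ([exact_order_ad_horner]).  As [f(a), b] is a nonzero multiple of b, and
      (d - 1) m > 0, the order of c is smaller than that of b.  But f(a)
      commutes with a, so c is again an eigenvector for lam, and it is nonzero
      since otherwise f(a) would commute with b.  This descends forever. *)

Set Implicit Arguments.
Unset Strict Implicit.
Unset Printing Implicit Defensive.

Import GRing.Theory.
Local Open Scope ring_scope.

(** * Commutators with polynomials in one element *)

Lemma adMl (K : fieldType) (A : algType K) (x y b : A) :
  ad (x * y) b = x * ad y b + ad x b * y.
Proof. by rewrite /ad mulrBr mulrBl !mulrA addrA subrK. Qed.

Lemma adZl (K : fieldType) (A : algType K) c (x b : A) :
  ad (c *: x) b = c *: ad x b.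
Proof. by rewrite /ad -scalerAl -scalerAr scalerBr. Qed.

Lemma ad_suml (K : fieldType) (A : algType K) n (x : 'I_n -> A) (b : A) :
  ad (\sum_i x i) b = \sum_i ad (x i) b.
Proof. by rewrite /ad mulr_suml mulr_sumr -sumrB. Qed.

Lemma horner_alg_sum (K : fieldType) (A : algType K) (a : A) (p : {poly K}) :
  horner_alg a p = \sum_(i < size p) p`_i *: a ^+ i.
Proof.
rewrite -{1}[p]coefK poly_def linear_sum.
by apply: eq_bigr => i _; rewrite linearZ rmorphXn /= horner_algX mulr_algl.
Qed.

Lemma ad_horner_alg (K : fieldType) (A : algType K) (a b : A) (p : {poly K}) :
  ad (horner_alg a p) b = \sum_(i < size p) p`_i *: ad (a ^+ i) b.
Proof.
by rewrite horner_alg_sum ad_suml; apply: eq_bigr => i _; rewrite adZl.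
Qed.

Lemma ad_commute (K : fieldType) (A : algType K) (x y b : A) :
  GRing.comm x y -> ad x (ad y b) = ad y (ad x b).
Proof.
move=> xy; rewrite /ad !mulrBr !mulrBl !mulrA xy -[b * y * x]mulrA -xy mulrA.
by rewrite !opprB addrACA [RHS]addrACA [- (x * b * y) - _]addrC.
Qed.

(** This makes [ad a] act on the eigenspaces of [ad f(a)]. *)
Lemma ad_comm_horner (K : fieldType) (A : algType K) (a b : A) (p : {poly K}) :
  ad (horner_alg a p) (ad a b) = ad a (ad (horner_alg a p) b).
Proof.
by apply: ad_commute; rewrite /GRing.comm -{2 3}[a]horner_algX -!rmorphM mulrC.
Qed.

Lemma ad_horner_eq0 (K : fieldType) (A : algType K) (a b : A) (p : {poly K}) :
  ad a b = 0 -> ad (horner_alg a p) b = 0.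
Proof.
move=> ab; rewrite ad_horner_alg big1 // => i _.
suff -> : ad (a ^+ i) b = 0 by rewrite scaler0.
elim: (val i) => [|j IH]; first by rewrite /ad expr0 mul1r mulr1 subrr.
by rewrite exprS adMl IH ab mulr0 mul0r addr0.
Qed.

(** * Filtered algebras whose graded ring is a commutative domain *)

(** The index is a strict bound: [F n] stands for order less than [n], so that
    [F 0] is zero and no order has to be given to the zero element.  An element
    of [F n.+1] outside [F n] has order exactly [n].  Hence the predecessors:
    orders below [m] and [n] add up to an order below [m + n - 1], and below
    [m + n - 2] for a commutator.  The last field says that the graded ring is
    a domain. *)
Record gr_comm_domain {K : fieldType} {A : algType K} (F : nat -> A -> Prop) :
    Prop := GrCommDomain {
  filt_eq0 : forall x, F 0 x -> x = 0;
  filt0 : forall n, F n 0;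
  filt1 : F 1 1;
  filtS : forall n x, F n x -> F n.+1 x;
  filt_exhaustive : forall x, exists n, F n x;
  filt_linear : forall n c x y, F n x -> F n y -> F n (c *: x + y);
  filtM : forall m n x y, F m x -> F n y -> F (m + n).-1 (x * y);
  filt_ad : forall m n x y, F m x -> F n y -> F (m + n).-2 (ad x y);
  filt_domain : forall m n x y, F m.+1 x -> ~ F m x -> F n.+1 y -> ~ F n y ->
    ~ F (m + n)%N (x * y) }.

Section Filtered.
Variables (K : fieldType) (A : algType K) (F : nat -> A -> Prop).
Hypotheses (char0 : [pchar K] =i pred0) (grF : gr_comm_domain F).

Lemma filtD n x y : F n x -> F n y -> F n (x + y).
Proof. by move=> Fx Fy; rewrite -[x]scale1r; apply: (filt_linear grF). Qed.

Lemma filtZ n c x : F n x -> F n (c *: x).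
Proof.
move=> Fx; rewrite -[_ *: _]addr0.
by apply: (filt_linear grF) => //; apply: (filt0 grF).
Qed.

Lemma filtB n x y : F n x -> F n y -> F n (x - y).
Proof.
by move=> Fx Fy; rewrite -scaleN1r; apply: filtD => //; apply: filtZ.
Qed.

Lemma filt_sum n k (x : 'I_k -> A) : (forall i, F n (x i)) -> F n (\sum_i x i).
Proof.
move=> Fx; apply: (big_ind (F n)) => [|y z|i _]; last exact: Fx.
  exact: (filt0 grF).
exact: filtD.
Qed.

Lemma filtW m n x : (m <= n)%N -> F m x -> F n x.
Proof.
move=> /subnKC <-; elim: (n - m)%N => [|k IH] Fx; first by rewrite addn0.
by rewrite addnS; apply: (filtS grF); apply: IH.
Qed.

Lemma filtZ_inv n c x : c != 0 -> F n (c *: x) -> F n x.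
Proof. by move=> c0 /(filtZ c^-1); rewrite scalerA mulVf // scale1r. Qed.

Lemma exact_order x : x != 0 -> exists2 n, F n.+1 x & ~ F n x.
Proof.
move=> x0; have [n] := filt_exhaustive grF x.
elim: n => [/(filt_eq0 grF) x_0|n IH Fn]; first by rewrite x_0 eqxx in x0.
by case: (pselect (F n x)) => [/IH|nF] //; exists n.
Qed.

Lemma exact_orderX m a i : F m.+1 a -> ~ F m a ->
  F (i * m).+1 (a ^+ i) /\ ~ F (i * m)%N (a ^+ i).
Proof.
move=> Fa nFa; elim: i => [|i [IH nIH]].
  rewrite mul0n expr0; split; first exact: (filt1 grF).
  by move=> /(filt_eq0 grF)/eqP; rewrite oner_eq0.
rewrite exprS mulSn; split; last exact: (filt_domain grF).
by have := filtM grF Fa IH; rewrite addnS.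
Qed.

(** By the Leibniz rule [a^(i+1), b] is the sum of the a^j [a, b] a^(i-j), and
    these i + 1 terms have the same symbol, as the graded ring is
    commutative. *)
Lemma ad_expr_leading m k a b i : F m.+1 a -> ~ F m a -> F k.+1 (ad a b) ->
  F (i * m + k)%N (ad (a ^+ i.+1) b - i.+1%:R *: (a ^+ i * ad a b)).
Proof.
move=> Fa nFa Fc; elim: i => [|i IH].
  by rewrite scale1r expr0 mul1r subrr; apply: (filt0 grF).
have [Fai _] := exact_orderX i.+1 Fa nFa.
move Ec: (ad a b) Fc IH => c Fc IH.
have -> : ad (a ^+ i.+2) b - i.+2%:R *: (a ^+ i.+1 * c) =
    a * (ad (a ^+ i.+1) b - i.+1%:R *: (a ^+ i * c)) + ad c (a ^+ i.+1).
  rewrite [a ^+ i.+2]exprS adMl Ec.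
  move: (ad (a ^+ i.+1) b) => v; rewrite mulrBr -scalerAr mulrA -exprS.
  rewrite /ad -[i.+2]addn1 natrD scalerDl scale1r opprD !addrA.
  by congr (_ - _); rewrite addrAC.
apply: filtD.
  by have := filtM grF Fa IH; rewrite mulSn addnA.
by have := filt_ad grF Fc Fai; rewrite addSn addnS /= addnC.
Qed.

(** Each factor of the leading term is nonzero in the graded ring (this is where
    characteristic zero enters), and as [a] has positive order the lower
    coefficients of [p] contribute only lower order. *)
Lemma exact_order_ad_horner m k d a b (p : {poly K}) :
    size p = d.+2 -> (0 < m)%N -> F m.+1 a -> ~ F m a ->
    F k.+1 (ad a b) -> ~ F k (ad a b) ->
  ~ F (d * m + k)%N (ad (horner_alg a p) b).
Proof.
move=> sp m0 Fa nFa Fc nFc Fu.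
have [Fad nFad] := exact_orderX d Fa nFa.
have lc : p`_d.+1 * d.+1%:R != 0.
  rewrite mulf_neq0 //; last by rewrite ((pcharf0P _).1 char0).
  have := lead_coef_eq0 p; rewrite lead_coefE sp /= => ->.
  by rewrite -size_poly_eq0 sp.
apply: (filt_domain grF Fad nFad Fc nFc).
apply: (filtZ_inv lc).
move: Fu; rewrite ad_horner_alg sp big_ord_recr /=.
set low := \sum_(i < _) _; set top := _ *: ad _ _ => Fu.
have Flow : F (d * m + k)%N low.
  apply: filt_sum => -[[|i] /= id]; apply: filtZ.
    by rewrite /ad expr0 mul1r mulr1 subrr; apply: (filt0 grF).
  have [Fai _] := exact_orderX i Fa nFa.
  have -> : ad (a ^+ i.+1) b =
      (ad (a ^+ i.+1) b - i.+1%:R *: (a ^+ i * ad a b)) +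
      i.+1%:R *: (a ^+ i * ad a b) by rewrite subrK.
  have lt : ((i * m + k).+1 <= d * m + k)%N by nia.
  apply: filtD.
    by apply: (filtW (m := i * m + k)); [exact: ltnW | apply: ad_expr_leading].
  apply: filtZ; apply: (filtW lt).
  by have := filtM grF Fai Fc; rewrite addnS.
have -> : (p`_d.+1 * d.+1%:R) *: (a ^+ d * ad a b) = (low + top) - low -
   p`_d.+1 *: (ad (a ^+ d.+1) b - d.+1%:R *: (a ^+ d * ad a b)).
  by rewrite scalerBr scalerA opprB addrCA [low + _]addrC addrK subrr addr0.
apply: filtB; first exact: filtB.
by apply: filtZ; apply: ad_expr_leading.
Qed.

Lemma filt1_horner a (p : {poly K}) : F 1 a -> F 1 (horner_alg a p).
Proof.
move=> Fa; rewrite horner_alg_sum; apply: filt_sum => i; apply: filtZ.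
elim: (val i) => [|j IH]; first by rewrite expr0; apply: (filt1 grF).
by rewrite exprS; have := filtM grF Fa IH.
Qed.

(** Infinite descent on the order of the eigenvector: [ad a b] is an eigenvector
    of smaller order for the same eigenvalue. *)
Lemma ad_horner_eigenvalue0 (a : A) (p : {poly K}) lam (b : A) :
  (1 < (size p).-1)%N ->
  b != 0 -> ad (horner_alg a p) b = lam *: b -> lam = 0.
Proof.
move=> degp; have [d sp d0] : exists2 d, size p = d.+2 & (0 < d)%N.
  by exists (size p).-2; move: degp; case: (size p) => [|[|]].
move=> b0 ub; apply/eqP; apply: contraT => lam0; exfalso.
have [n Fb] := filt_exhaustive grF b.
elim: n b b0 ub Fb => [|n IH] b b0 ub Fb.
  by move/(filt_eq0 grF)/eqP: Fb; rewrite (negPf b0).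
(* For [a] of order 0 the commutator with [p(a)] already lowers the order. *)
have [Fa1|nFa1] := pselect (F 1 a).
  apply: (IH b b0 ub); apply: (filtZ_inv lam0); rewrite -ub.
  exact: (filt_ad grF (filt1_horner p Fa1) Fb).
have [m Fa nFa] : exists2 m, F m.+1 a & ~ F m a.
  apply: exact_order; apply/eqP => a0; apply: nFa1.
  by rewrite a0; apply: (filt0 grF).
have m0 : (0 < m)%N by case: m Fa {nFa}.
have c0 : ad a b != 0.
  apply/eqP => c0; move/eqP: ub.
  by rewrite ad_horner_eq0 // eq_sym scaler_eq0 (negPf lam0) (negPf b0).
have [k Fc nFc] := exact_order c0.
apply: (IH _ c0).
  by rewrite ad_comm_horner ub linearZ.
(* Compare the exact order of [lam *: b] with the bound on that of [b]. *)
have := exact_order_ad_horner sp m0 Fa nFa Fc nFc.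
rewrite ub; case: (leqP n.+1 (d * m + k)%N) => [le|lt] nFu.
  by case: nFu; apply/filtZ/(filtW le).
by apply: (filtW (m := k.+1)) => //; nia.
Qed.

End Filtered.

(** * The order filtration on differential operators *)

Section Diffop.
Variables (K : fieldType) (R : idomainAlgType K).
Implicit Types (f g : endo R) (r : R).

(** The shift by one adds order -1, where the recursion on commutators
    ([order_ltS]) starts uniformly from the zero operator. *)
Definition order_lt (n : nat) (f : endo R) : Prop :=
  if n is i.+1 then diffop_order_le i f else f = 0.

Definition rcomm (r : R) (f : endo R) : endo R :=
  f * endo_mulop r - endo_mulop r * f.

Lemma order_ltS n f : order_lt n.+1 f <-> forall r, order_lt n (rcomm r f).
Proof. by case: n. Qed.

Lemma rcomm_is_linear r : linear (rcomm r).
Proof.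
move=> c x y; rewrite /rcomm mulrDl mulrDr scalerBr scalerAl scalerAr.
by rewrite opprD addrACA.
Qed.
HB.instance Definition _ r :=
  GRing.isLinear.Build K (endo R) (endo R) *:%R (rcomm r) (rcomm_is_linear r).

Lemma rcommM r f g : rcomm r (f * g) = rcomm r f * g + f * rcomm r g.
Proof. by rewrite /rcomm mulrBr mulrBl !mulrA [RHS]addrC addrA subrK. Qed.

Lemma order_lt0 n : order_lt n 0.
Proof. by case: n => // n; apply: diffop_order_le0. Qed.

Lemma order_lt_linear n c f g :
  order_lt n f -> order_lt n g -> order_lt n (c *: f + g).
Proof.
case: n => [-> ->|n]; first by rewrite /= scaler0 addr0.
exact: diffop_order_le_linear.
Qed.

Lemma order_ltM m n f g :
  order_lt m f -> order_lt n g -> order_lt (m + n).-1 (f * g).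
Proof.
case: m => [-> _|m Ff]; first by rewrite mul0r; apply: order_lt0.
case: n => [->|n Fg]; first by rewrite mulr0; apply: order_lt0.
by rewrite addSn addnS; apply: diffop_order_leM.
Qed.

Lemma order_lt_succ n f : order_lt n f -> order_lt n.+1 f.
Proof. by case: n => [->|n]; [apply: order_lt0 | apply: diffop_order_leS]. Qed.

(** An operator of order 0 is the multiplication by its value at 1. *)
Lemma order_lt1E f x : order_lt 1 f -> f x = x * f 1.
Proof.
move=> /(_ x)/(congr1 (fun h : endo R => h 1))/eqP.
by rewrite /= subr_eq0 /= mulr1 => /eqP.
Qed.

(** Commutation with [r] is a derivation, so it turns [f, g] into
    [[f, r], g] + [f, [g, r]], where one of the orders is smaller; operators of
    order 0 are multiplications, which commute. *)
Lemma order_lt_comm m n f g :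
  order_lt m f -> order_lt n g -> order_lt (m + n).-2 (ad f g).
Proof.
have [N] := ubnP (m + n); elim: N m n f g => // N IH [|m] [|n] f g lemn Ff Fg.
1-3: by rewrite /ad ?Ff ?Fg ?mul0r ?mulr0 subr0; apply: order_lt0.
have E r : rcomm r (ad f g) = ad (rcomm r f) g + ad f (rcomm r g).
  rewrite [in LHS]/ad linearB /= !rcommM /ad opprD.
  by rewrite [- (rcomm r g * f) - _]addrC addrACA.
rewrite addSn addnS /=; case mnE: (m + n)%N => [|k].
  move: mnE Ff Fg => /eqP; rewrite addn_eq0 => /andP[/eqP-> /eqP->] Ff Fg.
  rewrite /order_lt /ad; apply: endoP => x.
  transitivity (f (g x) - g (f x)) => //.
  rewrite (order_lt1E (g x) Ff) (order_lt1E (f x) Fg).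
  by rewrite (order_lt1E x Fg) (order_lt1E x Ff) mulrAC subrr.
apply/order_ltS => r; rewrite E -[ad (rcomm r f) g]scale1r.
apply: order_lt_linear.
  have -> : k = (m + n.+1).-2 by rewrite addnS mnE.
  by apply: IH; [lia | apply: (order_ltS _ _).1 | ].
have -> : k = (m.+1 + n).-2 by rewrite addSn mnE.
by apply: IH; [lia | | apply: (order_ltS _ _).1].
Qed.

Lemma order_lt_iter n p r f :
  order_lt (n + p) f -> order_lt n (iter p (rcomm r) f).
Proof.
elim: p n => [|p IH] n; first by rewrite addn0.
by rewrite addnS -addSn => /IH /order_ltS; apply.
Qed.

Lemma iter_rcommD p r f g :
  iter p (rcomm r) (f + g) = iter p (rcomm r) f + iter p (rcomm r) g.
Proof. by elim: p => //= p ->; rewrite linearD. Qed.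

Lemma order_ltD n f g : order_lt n f -> order_lt n g -> order_lt n (f + g).
Proof. by rewrite -[f in f + g]scale1r; apply: order_lt_linear. Qed.

(** In the Leibniz formula for the (p + q)-fold commutator of [f * g] with [r],
    each other term takes more than [p] commutators of [f] or more than [q] of
    [g], and so has lower order.  At [m = 0] the hypothesis on [f] says that its
    (p + 1)-fold commutator vanishes; likewise for [g]. *)
Lemma order_lt_leibniz m n p q r f g :
    order_lt (m + p).+1 f -> order_lt m.-1 (iter p.+1 (rcomm r) f) ->
    order_lt (n + q).+1 g -> order_lt n.-1 (iter q.+1 (rcomm r) g) ->
  order_lt (m + n) (iter (p + q) (rcomm r) (f * g) -
    'C(p + q, p)%:R *: (iter p (rcomm r) f * iter q (rcomm r) g)).
Proof.
elim: p f q g => [|p IHp] f.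
  elim=> [|q IHq] g Ff Df Fg Dg.
    by rewrite /= scale1r subrr; apply: order_lt0.
  rewrite !add0n !bin0 iterSr rcommM iter_rcommD -addrA iterSr.
  apply: order_ltD.
    apply: order_lt_iter; case: m Ff Df {IHq} => [|m] Ff Df.
      by rewrite [rcomm r f]Df mul0r; apply: order_lt0.
    by have := order_ltM Df Fg; rewrite !addnS !addSn addnA.
  have := IHq (rcomm r g) Ff Df; rewrite !add0n !bin0; apply.
    by apply: (order_ltS _ _).1; rewrite -addnS.
  by rewrite -iterSr.
elim=> [|q IHq] g Ff Df Fg Dg.
  have Frf : order_lt (m + p).+1 (rcomm r f).
    by apply: (order_ltS _ _).1; rewrite -addnS.
  rewrite !addn0 binn iterSr rcommM iter_rcommD addrAC.
  apply: order_ltD; last first.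
    apply: order_lt_iter; case: n Fg Dg {IHp} => [|n] Fg Dg.
      by rewrite [rcomm r g]Dg mulr0; apply: order_lt0.
    have := order_ltM Ff Dg; rewrite addSn /=; congr order_lt; lia.
  have L := IHp (rcomm r f) 0%N g Frf.
  by rewrite -!iterSr !addn0 binn in L; rewrite addn0 in Fg; apply: L.
have Frf : order_lt (m + p).+1 (rcomm r f).
  by apply: (order_ltS _ _).1; rewrite -addnS.
have Frg : order_lt (n + q).+1 (rcomm r g).
  by apply: (order_ltS _ _).1; rewrite -addnS.
have L := IHp (rcomm r f) q.+1 g Frf.
have M := IHq (rcomm r g) Ff Df Frg.
rewrite -!iterSr in L M.
have := order_ltD (L Df Fg Dg) (M Dg).
congr order_lt.
rewrite addrACA -opprD -scalerDl -natrD !addSn !addnS.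
rewrite [in RHS]binS [X in _ = _ - X%:R *: _]addnC.
by rewrite -iter_rcommD -rcommM -iterSr.
Qed.

(** A commutator with [r] lowers the order by at least one.  Take as many as
    possible while it drops by exactly one each time; at the latest this stops
    in order 0, as the next commutator is then zero. *)
Lemma last_exact_commutator m r f : order_lt m.+1 f -> ~ order_lt m f ->
  exists m' p, [/\ m = (m' + p)%N, order_lt m'.+1 (iter p (rcomm r) f),
    ~ order_lt m' (iter p (rcomm r) f) &
    order_lt m'.-1 (iter p.+1 (rcomm r) f)].
Proof.
elim: m f => [|m IH] f Ff nFf.
  by exists 0%N, 0%N; split=> //; apply: (order_ltS 0 f).1.
have [F1|nF1] := pselect (order_lt m (rcomm r f)).
  by exists m.+1, 0%N; rewrite addn0; split.
have [m' [p [-> F2 nF2 F3]]] := IH _ ((order_ltS _ _).1 Ff r) nF1.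
by exists m', p.+1; rewrite addnS !iterSr; split=> //; rewrite iterSr in F3.
Qed.

Hypothesis char0 : [pchar K] =i pred0.

(** Induction on the sum of the orders.  In orders 0 both factors are
    multiplications by elements of the domain [R].  Otherwise some [r] has a
    commutator with [f] or with [g] that lowers the order by exactly one.  For
    this [r] take the maximal numbers [p] and [q] of such commutators, so that
    [0 < p + q].  The symbol of the (p + q)-fold commutator of [f * g] is then a
    nonzero multiple of the product of two symbols of smaller total order. *)
Lemma order_lt_domain m n f g : order_lt m.+1 f -> ~ order_lt m f ->
  order_lt n.+1 g -> ~ order_lt n g -> ~ order_lt (m + n) (f * g).
Proof.
have [N] := ubnP (m + n); elim: N m n f g => // N IH m n f g lemn.
move=> Ff nFf Fg nFg Ffg.
have [mn0|mn0] := posnP (m + n).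
  move: mn0 Ff nFf Fg nFg Ffg => /eqP.
  rewrite addn_eq0 => /andP[/eqP-> /eqP->] Ff nFf Fg nFg Ffg.
  have nz h : order_lt 1 h -> ~ order_lt 0 h -> h 1 != 0.
    move=> Fh nFh; apply/eqP => h1; apply: nFh; apply: endoP => x.
    by rewrite (order_lt1E _ Fh) h1 mulr0.
  have := mulf_neq0 (nz g Fg nFg) (nz f Ff nFf).
  rewrite -(order_lt1E _ Ff) => /eqP; apply.
  by have := congr1 (fun h : endo R => h 1) Ffg.
have [r rfg] : exists r,
    ~ order_lt m.-1 (rcomm r f) \/ ~ order_lt n.-1 (rcomm r g).
  apply: contrapT => /forallNP nr.
  case: m n mn0 nFf nFg nr {lemn Ff Fg Ffg} => [|m] [|n] // _ nFf nFg nr.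
  - apply: nFg; apply/order_ltS => r.
    by apply: contrapT => nrg; apply: (nr r); right.
  - apply: nFf; apply/order_ltS => r.
    by apply: contrapT => nrf; apply: (nr r); left.
  - apply: nFf; apply/order_ltS => r.
    by apply: contrapT => nrf; apply: (nr r); left.
have [m' [p [mE Fpf nFpf Df]]] := last_exact_commutator r Ff nFf.
have [n' [q [nE Fqg nFqg Dg]]] := last_exact_commutator r Fg nFg.
have pq : (0 < p + q)%N.
  rewrite lt0n addn_eq0; apply/negP => /andP[/eqP p0 /eqP q0].
  by subst p q; rewrite !addn0 in mE nE; subst m' n'; case: rfg.
rewrite mE in Ff Ffg; rewrite nE in Fg Ffg.
apply: (IH m' n' _ _ _ Fpf nFpf Fqg nFqg); first by lia.
have c0 : 'C(p + q, p)%:R != 0 :> K.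
  by rewrite ((pcharf0P _).1 char0) -lt0n bin_gt0 leq_addr.
rewrite -[_ * _]scale1r -(mulVf c0) -scalerA -[_ *: _]addr0.
apply: order_lt_linear (order_lt0 _).
set t := _ *: _.
have -> : t = -1 *: (iter (p + q) (rcomm r) (f * g) - t) +
    iter (p + q) (rcomm r) (f * g) by rewrite scaleN1r opprB subrK.
apply: order_lt_linear; first exact: order_lt_leibniz.
by apply: order_lt_iter; rewrite addnACA.
Qed.

Lemma diffop_gr_comm_domain :
  gr_comm_domain (fun n (x : diffop R) => order_lt n (val x)).
Proof.
split.
- by move=> x x0; apply: val_inj.
- by move=> n; apply: order_lt0.
- by move=> r; rewrite mul1r mulr1 subrr.
- by move=> n x; apply: order_lt_succ.
- by move=> [f /= Ff]; have /diffop_predP[i fi] := Ff; exists i.+1.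
- by move=> n c x y; apply: order_lt_linear.
- by move=> m n x y; apply: order_ltM.
- by move=> m n x y; apply: order_lt_comm.
- by move=> m n x y; apply: order_lt_domain.
Qed.

End Diffop.

Theorem theorem1p2 (K : fieldType) (char0 : [pchar K] =i pred0)
    (R : idomainAlgType K) (affR : affine_algebra R) (regR : regular_ring R)
    (a : diffop R) (f : {poly K}) (degf : (1 < (size f).-1)%N) (lam : K) :
  is_eigenvalue (ad (horner_alg a f)) lam <-> lam = 0.
Proof.
split=> [[b b0 ub] | ->].
  have grD := diffop_gr_comm_domain R char0.
  exact: (ad_horner_eigenvalue0 char0 grD degf b0 ub).
by exists 1; [exact: oner_neq0 | rewrite /= /ad mulr1 mul1r subrr scale0r].
Qed.
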